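(* Let $n\in\mathbb{Z}$ and let $\theta_n$ be a root of $f_n(x)=x^3-nx^2+(n-1)x-1$. The ideal class monoid $C(\mathbb{Z}[\theta_n])$ is not a group if and only if there exist an integer $c$ and a prime number $p$ satisfying simultaneously (1) $(2c-1)\,n\equiv 3c^2-1 \pmod{p}$, and (2) $(c^2-c)\,n\equiv c^3-c-1 \pmod{p^2}$. Moreover, whenever an integer $c$ and a prime $p$ satisfy (1) and (2), the ideal $\langle \theta_n-c,\,p\rangle$ of $\mathbb{Z}[\theta_n]$ is not invertible.
   Context: $f_n$ is irreducible over $\mathbb{Q}$ for all $n$, so $\mathbb{Z}[\theta_n]$ is an order in the cubic number field $\mathbb{Q}(\theta_n)$. For an integral domain $R$, two nonzero ideals $I,J$ are equivalent if $\alpha I=\beta J$ for some nonzero $\alpha,\beta\in R$; the set of equivalence classes of nonzero ideals with the multiplication induced by ideal multiplication is a monoid with identity $[R]$, called the ideal class monoid $C(R)$. A nonzero ideal $I$ is invertible if $[I]$ is an invertible element of $C(R)$. *)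

(* Defs.v *)
From HB Require Import structures.
From mathcomp Require Import all_boot all_order all_algebra all_field.
Set Implicit Arguments. Unset Strict Implicit. Unset Printing Implicit Defensive.
Import Order.TTheory GRing.Theory Num.Theory.
Local Open Scope ring_scope.

Definition fpoly (n : int) : {poly int} :=
  'X^3 - n%:P * 'X^2 + (n - 1)%:P * 'X - 1.

Definition Zth (th : algC) : algC -> Prop :=
  fun x => exists p : {poly int}, x = (map_poly intr p).[th].

Definition is_ideal (th : algC) (I : algC -> Prop) : Prop :=
  [/\ (forall x, I x -> Zth th x), I 0,
      (forall x y, I x -> I y -> I (x + y)) &
      (forall r x, Zth th r -> I x -> I (r * x))].

Definition nonzero_ideal (th : algC) (I : algC -> Prop) : Prop :=
  is_ideal th I /\ exists x, I x /\ x != 0.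

Definition ideal_mul (I J : algC -> Prop) : algC -> Prop :=
  fun x => exists s : seq (algC * algC),
    (forall pr, pr \in s -> I pr.1 /\ J pr.2) /\
    x = \sum_(pr <- s) pr.1 * pr.2.

Definition ideal_equiv (th : algC) (I J : algC -> Prop) : Prop :=
  exists a b, [/\ Zth th a, a != 0, Zth th b, b != 0 &
    forall x, (exists y, I y /\ x = a * y) <-> (exists z, J z /\ x = b * z)].

(* [I] is an invertible element of the ideal class monoid C(Z[theta]) *)
Definition invertible_ideal (th : algC) (I : algC -> Prop) : Prop :=
  exists J, nonzero_ideal th J /\ ideal_equiv th (ideal_mul I J) (Zth th).

Definition class_monoid_is_group (th : algC) : Prop :=
  forall I, nonzero_ideal th I -> invertible_ideal th I.

Definition ideal2 (th : algC) (c p : int) : algC -> Prop :=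
  fun x => exists r1 r2, [/\ Zth th r1, Zth th r2 &
                             x = r1 * (th - c%:~R) + r2 * p%:~R].

(* Main.v *)
(* For an ideal [I] of [R = Z[th]] put [(R : I) = {y | y I <= R}]; [I] is
   invertible as soon as [1] lies in [I (R : I)].  Condition (1)-(2) says that
   [f] is singular at [(c, p)]: [p | f'(c)] and [p^2 | f(c)].

   At a singular point, let [q = (f - f(c)) / (x - c)]; then [w = q(th) / p]
   stabilises [(th - c, p)] but is not in [R], whereas every stabiliser of an
   invertible ideal lies in [R].

   If there is no singular point, each proper ideal [I] containing [N > 0] admits
   some [w] with [w I <= R] and [w I] not contained in [I].  Then
   [1 \in (I + w I) (R : I + w I)] implies [1 \in I (R : I)], and one concludes
   by induction on the ideals between [N R] and [R], since [R / N R] is finite.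
   To find [w], write [f = K H + p r] with [H] irreducible modulo [p] and [I]
   contained in [M = (p, H(th))], and take [w = K(th) / p].  Nonsingularity gives
   [1 = m0 + m1 w] with [m0, m1] in [M].  If [w I <= I], then all [w^i N] are in
   [R], so by pigeonhole modulo [N R] some [w^j - w^i], [i < j], is in [R], and
   raising [1 - m0 = m1 w] to the power [j] forces [1] into [M]. *)
Require Import Defs.
From HB Require Import structures.
From Stdlib Require Import Classical.
From mathcomp Require Import all_boot all_order all_algebra all_field.
From mathcomp Require Import ring zify.
Import Order.TTheory GRing.Theory Num.Theory.
Local Open Scope ring_scope.
Set Implicit Arguments. Unset Strict Implicit. Unset Printing Implicit Defensive.

(** * The polynomial [f_n] *)

Lemma fpolyE (n : int) : fpoly n = Poly [:: -1; n - 1; - n; 1].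
Proof.
apply/polyP=> i; rewrite coef_Poly /fpoly !(coefB, coefD, coefCM, coefXn, coefX, coef1).
by case: i => [|[|[|[|i]]]] //=; rewrite ?nth_nil; ring.
Qed.

Lemma polyseq_fpoly (n : int) : fpoly n = [:: -1; n - 1; - n; 1] :> seq int.
Proof. by rewrite fpolyE (@PolyK _ 0). Qed.

Lemma size_fpoly (n : int) : size (fpoly n) = 4%N.
Proof. by rewrite polyseq_fpoly. Qed.

Lemma monic_fpoly (n : int) : fpoly n \is monic.
Proof. by rewrite monicE lead_coefE polyseq_fpoly. Qed.

Lemma horner_fpoly (n c : int) :
  (fpoly n).[c] = c ^+ 3 - n * c ^+ 2 + (n - 1) * c - 1.
Proof. by rewrite /fpoly !hornerE. Qed.

(** * Evaluation at [th] and the ring [R = Z[th]] *)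

Definition ev (th : algC) (g : {poly int}) : algC := (map_poly intr g).[th].

Lemma evD th g h : ev th (g + h) = ev th g + ev th h.
Proof. by rewrite /ev rmorphD hornerD. Qed.

Lemma evN th g : ev th (- g) = - ev th g.
Proof. by rewrite /ev rmorphN hornerN. Qed.

Lemma evM th g h : ev th (g * h) = ev th g * ev th h.
Proof. by rewrite /ev rmorphM hornerM. Qed.

Lemma evC th c : ev th c%:P = c%:~R.
Proof. by rewrite /ev map_polyC hornerC. Qed.

Lemma evX th : ev th 'X = th.
Proof. by rewrite /ev map_polyX hornerX. Qed.

Lemma ev1 th : ev th 1 = 1.
Proof. by rewrite /ev rmorph1 hornerC. Qed.

Definition evE := (evD, evN, evM, evC, evX, ev1).

Lemma Zth_ev th g : Zth th (ev th g).
Proof. by exists g. Qed.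

Lemma ZthD th x y : Zth th x -> Zth th y -> Zth th (x + y).
Proof. by move=> [g ->] [h ->]; exists (g + h); rewrite -/(ev _ _) -/(ev th (g + h)) evD. Qed.

Lemma ZthM th x y : Zth th x -> Zth th y -> Zth th (x * y).
Proof. by move=> [g ->] [h ->]; exists (g * h); rewrite -/(ev th (g * h)) evM. Qed.

Lemma ZthN th x : Zth th x -> Zth th (- x).
Proof. by move=> [g ->]; exists (- g); rewrite -/(ev th (- g)) evN. Qed.

Lemma ZthB th x y : Zth th x -> Zth th y -> Zth th (x - y).
Proof. by move=> hx hy; apply: ZthD => //; apply: ZthN. Qed.

Lemma Zth_int th (c : int) : Zth th c%:~R.
Proof. by exists c%:P; rewrite -/(ev th _) evC. Qed.

Lemma Zth_nat th (c : nat) : Zth th c%:R.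
Proof. exact: Zth_int th c. Qed.

Lemma Zth1 th : Zth th 1.
Proof. exact: Zth_int th 1. Qed.

Lemma ZthX th k x : Zth th x -> Zth th (x ^+ k).
Proof.
move=> hx; elim: k => [|k IH]; first by rewrite expr0; apply: Zth1.
by rewrite exprS; apply: ZthM.
Qed.

(** * Coordinates, irreducibility and inverses in [Q(th)] *)

Lemma ev_fpoly n (th : algC) : root (map_poly intr (fpoly n)) th -> ev th (fpoly n) = 0.
Proof. by move/rootP. Qed.

Lemma Zth_coords n (th : algC) : root (map_poly intr (fpoly n)) th ->
  forall x, Zth th x ->
  exists a b d : int, x = a%:~R + b%:~R * th + d%:~R * th ^+ 2.
Proof.
move=> hf x [g ->]; rewrite -/(ev th g).
set r := Pdiv.Ring.rmodp g (fpoly n).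
have sr : (size r <= 3)%N.
  by rewrite -ltnS -(size_fpoly n) Pdiv.Ring.ltn_rmodpN0 // monic_neq0 ?monic_fpoly.
have -> : ev th g = ev th r.
  rewrite (Pdiv.RingMonic.rdivp_eq (monic_fpoly n) g) evD evM (ev_fpoly hf) //.
  by rewrite mulr0 add0r.
exists r`_0, r`_1, r`_2; rewrite /ev.
rewrite (@horner_coef_wide _ 3) ?(leq_trans (size_poly _ _)) //.
by rewrite !big_ord_recl big_ord0 !coef_map /= expr0 mulr1 expr1 addr0 addrA.
Qed.

Lemma Crat_ratr (r : rat) : (ratr r : algC) \in Crat.
Proof. by apply/CratP; exists r. Qed.

(** A reducible cubic has a rational root; here it would be an algebraic integer, hence an integer
    dividing [-1]. But [f(1) = -1], and [f(-1) = -2n - 1] is odd. *)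
Lemma fpoly_irreducible n : irreducible_poly (map_poly (intr : int -> rat) (fpoly n)).
Proof.
apply: cubic_irreducible.
  by rewrite size_map_inj_poly ?size_fpoly //; apply: intr_inj.
move=> r; apply/negP=> hr.
have hr' : root (map_poly intr (fpoly n)) (ratr r : algC).
  have : root (map_poly (ratr : rat -> algC) (map_poly intr (fpoly n))) (ratr r).
    by rewrite fmorph_root.
  by rewrite -map_poly_comp (eq_map_poly (g := intr)) // => z /=; rewrite ratr_int.
have hA : (ratr r : algC) \in Aint.
  apply: root_monic_Aint hr' _ _; first by rewrite monic_map ?monic_fpoly.
  by apply/polyOverP=> i; rewrite coef_map /= intr_int.
have /intrP[z rz] := Cint_rat_Aint (Crat_ratr r) hA.
move: hr'; rewrite rz /root horner_map intr_eq0 horner_fpoly => /eqP h.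
have /intUnitRing.unitzPl : (z ^+ 2 - n * z + (n - 1)) * z = 1.
  by apply/eqP; rewrite -subr_eq0 -h; apply/eqP; ring.
rewrite qualifE /= => /orP[] /eqP ez; move: h; rewrite ez; lia.
Qed.

Lemma horner_ratr th (g : {poly int}) :
  (map_poly (ratr : rat -> algC) (map_poly (intr : int -> rat) g)).[th] = ev th g.
Proof.
rewrite /ev -map_poly_comp (eq_map_poly (g := intr)) // => z /=.
exact: ratr_int.
Qed.

(** Inverts [g(th)] in [Q(th)]: evaluate at [th] a Bezout relation between [f] and [g], which are
    coprime by irreducibility. *)
Lemma Bezout_ev n (th : algC) : root (map_poly intr (fpoly n)) th ->
  forall g : {poly int},
  ~~ (map_poly (intr : int -> rat) (fpoly n) %| map_poly intr g) ->
  exists v : {poly rat}, (map_poly (ratr : rat -> algC) v).[th] * ev th g = 1.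
Proof.
move=> hf g.
rewrite -irreducible_poly_coprime; last exact: fpoly_irreducible.
case/Bezout_eq1_coprimepP=> -[u v] /= uv; exists v.
have := congr1 (fun q => (map_poly (ratr : rat -> algC) q).[th]) uv.
rewrite /= rmorphD !rmorphM hornerD !hornerM !horner_ratr (ev_fpoly hf) //.
by rewrite mulr0 add0r rmorph1 hornerC.
Qed.

(** Clear the denominators of the inverse of [x]. Consequently every nonzero ideal contains a
    nonzero integer. *)
Lemma Zth_div_int n (th : algC) : root (map_poly intr (fpoly n)) th ->
  forall x, Zth th x -> x != 0 ->
  exists D : int, D != 0 /\ exists y, Zth th y /\ y * x = D%:~R.
Proof.
move=> hf x [g ->]; rewrite -/(ev th g) => gx.
have [|v vg] := Bezout_ev hf (g := g).
  apply: contra gx => /dvdpP[q Eq].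
  by rewrite -horner_ratr Eq rmorphM hornerM horner_ratr (ev_fpoly hf) // mulr0.
have [v' [D D0 Ev]] := rat_poly_scale v.
exists D; split=> //; exists (ev th v'); split; first exact: Zth_ev.
have rD : ratr (D%:~R^-1) = D%:~R^-1 :> algC by rewrite fmorphV /= ratr_int.
move: vg; rewrite Ev map_polyZ hornerZ horner_ratr.
set q := (X in X * _ * _); have -> : q = D%:~R^-1 by exact: rD.
rewrite -mulrA; by move/(canRL (mulKf _))=> ->; rewrite ?mulr1 ?invrK // invr_eq0 intr_eq0.
Qed.

(** A polynomial of degree 2 is not divisible by the cubic [f], so its value at [th] is invertible
    in [Q(th)]. *)
Lemma coord2_eq0 n (th : algC) : root (map_poly intr (fpoly n)) th ->
  forall a b d : int, a%:~R + b%:~R * th + d%:~R * th ^+ 2 = 0 -> d = 0.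
Proof.
move=> hf a b d E; apply/eqP/contraT=> d0.
pose g : {poly int} := Poly [:: a; b; d].
have sg : g = [:: a; b; d] :> seq int by rewrite (@PolyK _ 0).
have toQ_size (h : {poly int}) : size (map_poly (intr : int -> rat) h) = size h.
  by rewrite size_map_inj_poly //; apply: intr_inj.
have [|v] := Bezout_ev hf (g := g).
  apply/negP=> /dvdp_leq; rewrite !toQ_size size_fpoly sg /= => H.
  suff /H : map_poly (intr : int -> rat) g != 0 by [].
  by rewrite -size_poly_eq0 toQ_size sg.
have -> : ev th g = 0.
  rewrite -E /ev (@horner_coef_wide _ 3) ?(leq_trans (size_poly _ _)) ?sg //.
  by rewrite !big_ord_recl big_ord0 !coef_map /= sg /= expr0 mulr1 expr1 addr0 addrA.
by rewrite mulr0 => /esym/eqP; rewrite oner_eq0.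
Qed.

(** * Products of ideals and invertibility *)

Lemma ideal_mulP (I J : algC -> Prop) x y : I x -> J y -> ideal_mul I J (x * y).
Proof.
move=> Ix Jy; exists [:: (x, y)]; rewrite big_seq1; split=> // pr.
by rewrite inE => /eqP->.
Qed.

Lemma ideal_mul0 (I J : algC -> Prop) : ideal_mul I J 0.
Proof. by exists [::]; rewrite big_nil. Qed.

Lemma ideal_mulD (I J : algC -> Prop) x y :
  ideal_mul I J x -> ideal_mul I J y -> ideal_mul I J (x + y).
Proof.
move=> [s [hs ->]] [t [ht ->]]; exists (s ++ t); rewrite big_cat; split=> // pr.
by rewrite mem_cat => /orP[/hs|/ht].
Qed.

Lemma ideal_mul_ind (I J P : algC -> Prop) :
  P 0 -> (forall x y, P x -> P y -> P (x + y)) ->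
  (forall x y, I x -> J y -> P (x * y)) -> forall x, ideal_mul I J x -> P x.
Proof.
move=> P0 PD Pm x [s [hs ->]]; rewrite big_seq; apply: big_ind => // pr /hs[].
exact: Pm.
Qed.

(** If [a I J = b R], then [b = a y] with [y] in [I J]; as [w] stabilises [I J] too, [w b = a (w y)]
    lies in [b R], and [b] cancels. *)
Lemma stabilizer_invertible th (I : algC -> Prop) w :
  (forall x, I x -> I (w * x)) -> invertible_ideal th I -> Zth th w.
Proof.
move=> wI [J [_ [a [b [_ a0 _ b0 E]]]]].
have [_ /(_ _)[|y [IJy Eb]]] := E b.
  by exists 1; split; [exact: Zth1 | rewrite mulr1].
have wIJ : ideal_mul I J (w * y).
  elim/ideal_mul_ind: IJy => [|u v|u v Iu Jv].
  - by rewrite mulr0; apply: ideal_mul0.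
  - by rewrite mulrDr; apply: ideal_mulD.
  - by rewrite mulrA; apply: ideal_mulP => //; apply: wI.
have [z [Rz Ez]] := proj1 (E (a * (w * y))) (ex_intro _ _ (conj wIJ erefl)).
suff -> : w = z by [].
by apply: (mulIf b0); rewrite [in LHS]Eb mulrCA Ez mulrC.
Qed.

(** Here [y] ranges over all of [algC]; a nonzero [x] in [I] already forces [y = (y x) / x] into
    [Q(th)]. *)
Definition colon_ring (th : algC) (I : algC -> Prop) : algC -> Prop :=
  fun y => forall x, I x -> Zth th (y * x).

(** The inverse class must come from an ideal inside [R], so [(R : I)] is scaled by a nonzero [d] in
    [I]: the witness is [J = d (R : I)], written without division, and [I J = d R]. *)
Lemma invertible_colon_ring th I : nonzero_ideal th I ->
  ideal_mul I (colon_ring th I) 1 -> invertible_ideal th I.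
Proof.
move=> [[IR I0 ID IM] [d [Id d0]]] I1.
exists (fun z => Zth th z /\ forall x, I x -> exists r, Zth th r /\ z * x = d * r).
split; first split.
- split=> [x []//||x y [Rx hx] [Ry hy]|r x Rr [Rx hx]].
  + split=> [|x Ix]; first exact: (Zth_int th 0).
    by exists 0; rewrite mul0r mulr0; split=> //; apply: (Zth_int th 0).
  + split=> [|z Iz]; first exact: ZthD.
    have [[r [Rr Er]] [s [Rs Es]]] := (hx z Iz, hy z Iz).
    by exists (r + s); rewrite mulrDl mulrDr Er Es; split=> //; apply: ZthD.
  + split=> [|z Iz]; first exact: ZthM.
    have [s [Rs Es]] := hx z Iz.
    by exists (r * s); rewrite -mulrA Es mulrCA; split=> //; apply: ZthM.
- exists d; split=> //; split=> [|x Ix]; first exact: IR.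
  by exists x; split=> //; apply: IR.
exists 1, d; split; rewrite ?oner_eq0 //; [exact: Zth1 | exact: IR |].
move=> x; split=> [[y [IJy ->]]|[z [Rz ->]]].
  rewrite mul1r; elim/ideal_mul_ind: IJy => [|u v|u v Iu [Rv /(_ u Iu)[r [Rr E]]]].
  - by exists 0; rewrite mulr0; split=> //; apply: (Zth_int th 0).
  - move=> [r [Rr ->]] [s [Rs ->]].
    by exists (r + s); rewrite mulrDr; split=> //; apply: ZthD.
  - by exists r; rewrite mulrC.
(* Expand the 1 in [d z = (d z) 1] as a sum of products [u v] with [v] in [(R : I)]; each [d z v]
   lies in [J]. *)
exists (d * z); rewrite mul1r; split=> //.
rewrite -[d * z]mulr1; elim/ideal_mul_ind: I1 => [|u v|u v Iu Kv].
- by rewrite mulr0; apply: ideal_mul0.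
- by rewrite mulrDr; apply: ideal_mulD.
rewrite mulrCA; apply: ideal_mulP => //; split=> [|x' Ix'].
  by rewrite mulrAC mulrC; apply: ZthM => //; rewrite mulrC; apply: Kv.
by exists (z * (v * x')); split; [apply: ZthM => //; apply: Kv | ring].
Qed.

Definition enlarge (I : algC -> Prop) (w : algC) : algC -> Prop :=
  fun x => exists a b, [/\ I a, I b & x = a + w * b].

Lemma is_ideal_enlarge th I w : is_ideal th I -> colon_ring th I w ->
  is_ideal th (enlarge I w).
Proof.
move=> [IR I0 ID IM] wI; split.
- by move=> _ [a [b [Ia Ib ->]]]; apply: ZthD; [apply: IR | apply: wI].
- by exists 0, 0; rewrite mulr0 addr0.
- move=> _ _ [a [b [Ia Ib ->]]] [c [e [Ic Ie ->]]].
  by exists (a + c), (b + e); split; [apply: ID | apply: ID | ring].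
- move=> r _ Rr [a [b [Ia Ib ->]]].
  by exists (r * a), (r * b); split; [apply: IM | apply: IM | ring].
Qed.

(* If [x = a + w b] with [a, b] in [I] and [y (I + w I)] is integral, then
   [x y = a y + b (w y)], where both [y I] and [w y I] are integral. *)
Lemma colon_ring_enlarge th I w : I 0 ->
  ideal_mul (enlarge I w) (colon_ring th (enlarge I w)) 1 ->
  ideal_mul I (colon_ring th I) 1.
Proof.
move=> I0; elim/ideal_mul_ind => [|x y|_ y [a [b [Ia Ib ->]]] hy].
- exact: ideal_mul0.
- exact: ideal_mulD.
rewrite mulrDl [w * b]mulrC -mulrA.
apply: ideal_mulD; apply: ideal_mulP => // x Ix.
  by apply: hy; exists x, 0; rewrite mulr0 addr0.
by rewrite mulrAC mulrC; apply: hy; exists 0, x; rewrite add0r.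
Qed.

(** * Finiteness of [R / N R] and the induction on ideals *)

Definition residue_rep (th : algC) N (t : 'I_N * 'I_N * 'I_N) : algC :=
  (t.1.1 : nat)%:R + (t.1.2 : nat)%:R * th + (t.2 : nat)%:R * th ^+ 2.

Lemma int_residue N (a : int) : (0 < N)%N ->
  exists (i : 'I_N) (q : int), a = i%:Z + N%:Z * q.
Proof.
move=> N0; have hlt : (`|(a %% N%:Z)%Z|%N < N)%N.
  have := ltz_pmod a (d := N%:Z); have := modz_ge0 a (d := N%:Z); lia.
exists (Ordinal hlt), (a %/ N%:Z)%Z => /=.
have := modz_ge0 a (d := N%:Z); have := divz_eq a N%:Z; lia.
Qed.

Lemma Zth_residue n (th : algC) N : root (map_poly intr (fpoly n)) th ->
  (0 < N)%N -> forall x, Zth th x ->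
  exists (t : 'I_N * 'I_N * 'I_N) (y : algC),
    Zth th y /\ x = residue_rep th t + N%:R * y.
Proof.
move=> hf N0 x /(Zth_coords hf)[a [b [d ->]]].
have [[i [q ->]] [j [r ->]] [k [s ->]]] :=
  And3 (int_residue a N0) (int_residue b N0) (int_residue d N0).
exists (i, j, k), (ev th (q%:P + r%:P * 'X + s%:P * ('X * 'X))).
split; first exact: Zth_ev.
by rewrite /residue_rep !evE /= !rmorphD !rmorphM /= -!pmulrn; ring.
Qed.

(** Among more than [N ^ 3] exponents, two give the same residue of [w ^+ i * N] modulo [N R]; then
    divide by [N]. *)
Lemma pow_pigeonhole n (th : algC) N w : root (map_poly intr (fpoly n)) th ->
  (0 < N)%N -> (forall i, Zth th (w ^+ i * N%:R)) ->
  exists i j, (i < j)%N /\ Zth th (w ^+ j - w ^+ i).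
Proof.
move=> hf N0 wN; pose T : finType := ('I_N * 'I_N * 'I_N)%type.
have [t ht] := fin_all_exists (fun i : 'I_#|T|.+1 => Zth_residue hf N0 (wN i)).
have /injectivePn[i [j ij tij]] : ~~ injectiveb t.
  by apply/injectiveP=> /leq_card; rewrite card_ord ltnn.
have Nneq0 : N%:R != 0 :> algC by rewrite pnatr_eq0 -lt0n.
have E (i' j' : 'I_#|T|.+1) : t i' = t j' -> Zth th (w ^+ j' - w ^+ i').
  move=> tij'; have [[y [Ry Ey]] [z [Rz Ez]]] := (ht i', ht j').
  suff -> : w ^+ j' - w ^+ i' = z - y by apply: ZthB.
  apply: (mulIf Nneq0); rewrite mulrBl Ey Ez tij'; ring.
move: ij; rewrite neq_ltn => /orP[ij|ji].
  by exists i, j; split=> //; apply: E.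
by exists j, i; split=> //; apply: E.
Qed.

(* Raise [1 - m0 = m1 w] to the power [j]. *)
Lemma ideal1_of_integral th M m0 m1 w i j : is_ideal th M -> M m0 -> M m1 ->
  1 = m0 + m1 * w -> (i < j)%N -> Zth th (w ^+ j - w ^+ i) -> M 1.
Proof.
move=> [MR M0 MD MM] Mm0 Mm1 E ij Rr.
have R1m0 : Zth th (1 - m0) by apply: ZthB; [apply: Zth1 | apply: MR].
(* [1 - m0] is 1 modulo [M], and so are its powers. *)
have Mpow k : M (1 - (1 - m0) ^+ k).
  elim: k => [|k IH]; first by rewrite expr0 subrr.
  have -> : 1 - (1 - m0) ^+ k.+1 = 1 - (1 - m0) ^+ k + (1 - m0) ^+ k * m0.
    by rewrite exprSr; ring.
  by apply: MD => //; apply: MM => //; apply: ZthX.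
have Mj : M ((1 - m0) ^+ j).
  (* Split [(m1 w)^j = m1^j (w^j - w^i) + m1^(j-i) (m1 w)^i]; since [i < j], a factor [m1] comes out
     of both terms. *)
  have -> : (1 - m0) ^+ j =
      (m1 ^+ (j - i).-1 * (1 - m0) ^+ i) * m1 +
      ((w ^+ j - w ^+ i) * m1 ^+ j.-1) * m1.
    have E1 : 1 - m0 = m1 * w by rewrite [in LHS]E; ring.
    rewrite E1 !exprMn; have -> : m1 ^+ j = m1 ^+ j.-1 * m1.
      by rewrite -exprSr prednK // (leq_ltn_trans _ ij).
    have : m1 ^+ j.-1 * m1 = m1 ^+ (j - i).-1 * m1 ^+ i * m1.
      by rewrite -exprD; congr (_ ^+ _ * _); lia.
    move=> X; apply/eqP; rewrite -subr_eq0; apply/eqP.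
    transitivity ((m1 ^+ j.-1 * m1 - m1 ^+ (j - i).-1 * m1 ^+ i * m1) * w ^+ i).
      by ring.
    by rewrite X subrr mul0r.
  by apply: MD; apply: MM => //; apply: ZthM => //; apply: ZthX => //; apply: MR.
by rewrite -(subrK ((1 - m0) ^+ j) 1); apply: MD.
Qed.

Lemma colon_ring_of_step n (th : algC) N : root (map_poly intr (fpoly n)) th ->
  (0 < N)%N ->
  (forall I, is_ideal th I -> I N%:R -> ~ I 1 ->
     exists w, colon_ring th I w /\ exists x, I x /\ ~ I (w * x)) ->
  forall I, is_ideal th I -> I N%:R -> ideal_mul I (colon_ring th I) 1.
Proof.
move=> hf N0 step I idI IN; pose T : finType := ('I_N * 'I_N * 'I_N)%type.
have: forall t, t \in (set0 : {set T}) -> I (residue_rep th t).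
  by move=> t; rewrite inE.
(* [A] records indices of residues known to lie in [I], and the induction is on the size of its
   complement. Replacing [I] by [I + w I] adds to [A] the index of [w x]. *)
move: set0 => A; have [m] := ubnP #|~: A|.
elim: m => // m IHm in I A idI IN *; rewrite ltnS => Am AI.
have [IR I0 ID IM] := idI.
have [I1|nI1] := classic (I 1).
  by rewrite -[1]mulr1; apply: ideal_mulP => // x Ix; rewrite mul1r; apply: IR.
have [w [wI [x [Ix nIwx]]]] := step I idI IN nI1.
have [t [y [Ry E]]] := Zth_residue hf N0 (wI x Ix).
apply: (@colon_ring_enlarge _ _ w) => //.
apply: (IHm _ (t |: A)).
- exact: is_ideal_enlarge.
- by exists N%:R, 0; rewrite mulr0 addr0.
- apply: leq_trans Am; apply: proper_card; apply/properP; split.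
    by rewrite setCS subsetUr.
  exists t; rewrite !inE ?eqxx //; apply/negP=> /AI It; apply: nIwx.
  by rewrite E mulrC; apply: ID => //; rewrite mulrC mulrC; apply: IM.
- move=> s; rewrite !inE => /orP[/eqP->|/AI Is]; last first.
    by exists (residue_rep th s), 0; rewrite mulr0 addr0.
  (* The residue of [w x] is [w x - N y], and [N y] is in [I]. *)
  exists (- y * N%:R), x; split=> //; first by apply: IM => //; apply: ZthN.
  by rewrite E; ring.
Qed.

(** * Reduction modulo [p] and singular points *)

Lemma exists_min_size (F : fieldType) (P : {poly F} -> Prop) :
  (exists g, P g) -> exists g, P g /\ forall h, P h -> (size g <= size h)%N.
Proof.
move=> [g Pg]; have [m] := ubnP (size g).
elim: m => // m IHm in g Pg *; rewrite ltnS => gm.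
have [[h [Ph hg]]|nex] := classic (exists h, P h /\ (size h < size g)%N).
  by apply: (IHm h) => //; apply: leq_trans gm.
exists g; split=> // h Ph; rewrite leqNgt; apply/negP=> hg.
by apply: nex; exists h.
Qed.

Lemma poly_int_reduction (F : fieldType) p : p \in [char F] ->
  forall g : {poly int}, map_poly (intr : int -> F) g = 0 ->
  exists r, g = p%:Z%:P * r.
Proof.
move=> pF g g0; exists (map_poly (fun z => (z %/ p%:Z)%Z) g).
apply/polyP=> i; rewrite coefCM coef_map_id0 ?div0z // mulrC divzK //.
by rewrite (dvdz_pcharf pF) -coef_map g0 coef0.
Qed.

Lemma poly_Fp_lift p (g : {poly 'F_p}) :
  exists G : {poly int}, map_poly intr G = g.
Proof.
exists (map_poly (fun x : 'F_p => (x : nat)%:Z) g).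
by apply/polyP=> i; rewrite coef_map coef_map_id0 //= -pmulrn natr_Zp.
Qed.

(** For [p] prime, this says that [f] lies in the square of the maximal ideal [(X - c, p)] of
    [Z[X]]: expand [f] at [c] to first order. *)
Definition singular_at (n c : int) (p : nat) : Prop :=
  (p%:Z %| (fpoly n)^`().[c])%Z /\ ((p ^ 2)%N%:Z %| (fpoly n).[c])%Z.

(** The two sides of the congruences differ by [- f'(c)] and [- f(c)]. *)
Lemma singular_atP n c p :
  singular_at n c p <->
  ((2 * c - 1) * n == 3 * c ^+ 2 - 1 %[mod p%:Z])%Z /\
  ((c ^+ 2 - c) * n == c ^+ 3 - c - 1 %[mod (p ^ 2)%:Z])%Z.
Proof.
have dvdzN d m : (d %| - m)%Z = (d %| m)%Z by exact: rpredN.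
have E1 : (fpoly n)^`().[c] = - ((2 * c - 1) * n - (3 * c ^+ 2 - 1)).
  rewrite /fpoly !derivE !hornerE /=; ring.
have E2 : (fpoly n).[c] = - ((c ^+ 2 - c) * n - (c ^+ 3 - c - 1)).
  by rewrite horner_fpoly; ring.
by rewrite /singular_at !eqz_mod_dvd E1 E2 !dvdzN.
Qed.

(** When a prime factor [p] of [N] is a unit modulo [I], [N / p] is still in [I]. This descent
    cannot reach 1, so it stops at a prime that is not a unit modulo [I]. *)
Lemma prime_coprime_ideal th I N : is_ideal th I -> (0 < N)%N -> I N%:R ->
  ~ I 1 -> exists p, prime p /\ forall y, Zth th y -> ~ I (1 - p%:R * y).
Proof.
move=> [IR I0 ID IM] + + nI1; have [m] := ubnP N.
elim: m => // m IHm in N *; rewrite ltnS => Nm N0 IN.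
have [|N1] := leqP N 1.
  by rewrite leq_eqVlt ltnS leqNgt N0 orbF => /eqP N1; rewrite N1 in IN.
have pp := pdiv_prime N1; set p := pdiv N in pp.
have [[y [Ry Iy]]|nex] := classic (exists y, Zth th y /\ I (1 - p%:R * y)).
  have EN : N = (N %/ p * p)%N by rewrite divnK // pdiv_dvd.
  apply: (IHm (N %/ p)%N).
  - by apply: leq_trans Nm; rewrite ltn_Pdiv // prime_gt1.
  - by rewrite divn_gt0 ?prime_gt0 // dvdn_leq // pdiv_dvd.
  have -> : (N %/ p)%N%:R = (N %/ p)%N%:R * (1 - p%:R * y) + y * N%:R.
    by rewrite [in N%:R]EN natrM; ring.
  by apply: ID; apply: IM => //; apply: Zth_nat.
by exists p; split=> // y Ry Iy; apply: nex; exists y.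
Qed.

(* [I] lies in the maximal ideal [(p, H(th))]. *)
Lemma proper_ideal_reduction th I N : is_ideal th I -> (0 < N)%N -> I N%:R ->
  ~ I 1 -> (exists2 g : {poly int}, g \is monic & I (ev th g)) ->
  exists p (H : {poly int}), [/\ prime p,
    irreducible_poly (map_poly (intr : int -> 'F_p) H) &
    forall G : {poly int}, I (ev th G) ->
      map_poly (intr : int -> 'F_p) H %| map_poly intr G].
Proof.
move=> idI N0 IN nI1 [f fmon If].
have [p [pp hp]] := prime_coprime_ideal idI N0 IN nI1.
have [IR I0 ID IM] := idI; have pF := pchar_Fp pp.
pose red := map_poly (intr : int -> 'F_p).
pose P g := exists G, red G = g /\ I (ev th G).
(* [g0] generates the image of [I] in [F_p[X]], which is not 0 because it contains the reduction of
   a monic polynomial. *)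
have [|g0 [[g0N0 [G0 [EG0 IG0]]] g0min]] :=
    exists_min_size (P := fun g => g != 0 /\ P g).
  exists (red f); split; last by exists f.
  by rewrite monic_neq0 // monic_map.
have g0dvd G : I (ev th G) -> g0 %| red G.
  move=> IG; apply/contraT=> ndvd; have /negP[] : ~~ (size (red G %% g0)%R < size g0)%N.
    rewrite -leqNgt; apply: g0min; split=> //.
    have [Q EQ] := poly_Fp_lift (red G %/ g0); exists (G - Q * G0); split.
      rewrite /red rmorphB rmorphM /= EQ -/red -/(red G) EG0.
      by apply/eqP; rewrite subr_eq addrC -divp_eq.
    rewrite evD evN evM; apply: ID => //; rewrite -mulNr; apply: IM => //.
    by apply: ZthN; apply: Zth_ev.
  by rewrite ltn_modp.
(* A constant [g0] would put some [1 - p y], [y] in [R], into [I], against the choice of [p]. *)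
have g0size : (1 < size g0)%N.
  rewrite ltn_neqAle lt0n size_poly_eq0 g0N0 andbT eq_sym.
  apply/negP=> /size_poly1P[c c0 Ec].
  have [C EC] := poly_Fp_lift (c^-1%:P).
  have [|r Er] := @poly_int_reduction _ p pF (1 - C * G0).
    by rewrite rmorphB rmorphM rmorph1 /= EC -/(red G0) EG0 Ec -polyCM mulVf // subrr.
  apply: (hp (ev th r)); first exact: Zth_ev.
  have -> : 1 - p%:R * ev th r = ev th C * ev th G0.
    have := congr1 (ev th) Er; rewrite evD ev1 evN !evM evC -pmulrn => <-.
    by rewrite opprB addrC subrK.
  by apply: IM => //; apply: Zth_ev.
(* A nonconstant common divisor of least degree is irreducible: its nonconstant factors are common
   divisors too. *)
have [|h [[hsize hdvd] hmin]] :=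
    exists_min_size (P := fun h => (1 < size h)%N /\
                                   forall G, I (ev th G) -> h %| red G).
  by exists g0.
have [H EH] := poly_Fp_lift h; exists p, H; rewrite EH; split=> //; split=> // q q1 qh.
have hN0 : h != 0 by rewrite -size_poly_gt0 (leq_trans _ hsize).
rewrite -dvdp_size_eqp // eqn_leq dvdp_leq //= hmin //; split=> [|G /hdvd].
  by rewrite ltn_neqAle eq_sym q1 size_poly_gt0 (dvdpN0 qh).
exact: dvdp_trans.
Qed.

(** The square of [h = H mod p] divides the cubic [f mod p], so [h] is linear. For a lift [c] of its
    root, [p] divides [H(c)], [K(c)] and [r(c)]; hence [p ^ 2] divides [f(c)], and [p] divides
    [f'(c)] by the product rule. *)
Lemma singular_of_double_factor p (n : int) (H K r : {poly int}) : prime p ->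
  fpoly n = K * H + p%:Z%:P * r ->
  (1 < size (map_poly (intr : int -> 'F_p) H))%N ->
  map_poly (intr : int -> 'F_p) H %| map_poly intr K ->
  map_poly (intr : int -> 'F_p) H %| map_poly intr r ->
  exists c, singular_at n c p.
Proof.
move=> pp Ef; set h := map_poly _ H => hsize hk hr; have pF := pchar_Fp pp.
have Efp : map_poly (intr : int -> 'F_p) (fpoly n) = map_poly intr K * h.
  rewrite Ef rmorphD !rmorphM /= map_polyC /= -/h.
  have -> : p%:Z%:~R = 0 :> 'F_p by rewrite -pmulrn; apply: pcharf0.
  by rewrite mul0r addr0.
have fN0 : map_poly (intr : int -> 'F_p) (fpoly n) != 0.
  by rewrite monic_neq0 // monic_map // monic_fpoly.
have hsize2 : size h = 2%N.
  have : h * h %| map_poly (intr : int -> 'F_p) (fpoly n).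
    by rewrite Efp dvdp_mul.
  move/dvdp_leq => /(_ fN0)/leq_trans/(_ (size_poly _ _)).
  have hN0 : h != 0 by rewrite -size_poly_gt0 (leq_trans _ hsize).
  rewrite size_mul // size_fpoly; move: hsize.
  by case: (size h) => [|[|[|k]]] //; rewrite !addSn !addnS.
have [x /rootP hx] := poly2_root hsize2.
pose c : int := (x : nat)%:Z; exists c.
have cx : c%:~R = x by rewrite /c -pmulrn natr_Zp.
have div (g : {poly int}) : h %| map_poly intr g -> (p%:Z %| g.[c])%Z.
  case/dvdpP=> q Eq; rewrite (dvdz_pcharf pF) -horner_map /= cx Eq hornerM hx.
  by rewrite mulr0.
have /dvdzP[a Ea] := div H (dvdpp _).
have /dvdzP[b Eb] := div K hk.
have /dvdzP[e Ee] := div r hr.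
split; rewrite Ef ?derivE !hornerE Ea Eb ?Ee.
  by apply/dvdzP; exists (K^`().[c] * a + b * H^`().[c] + r^`().[c]); ring.
by apply/dvdzP; exists (b * a + e); rewrite PoszM; ring.
Qed.

(** * Without singular points, every nonzero ideal is invertible *)

Lemma colon_ring_step n (th : algC) N : root (map_poly intr (fpoly n)) th ->
  (0 < N)%N -> (forall c p, prime p -> ~ singular_at n c p) ->
  forall I, is_ideal th I -> I N%:R -> ~ I 1 ->
  exists w, colon_ring th I w /\ exists x, I x /\ ~ I (w * x).
Proof.
move=> hf N0 nsing I idI IN nI1; have [IR I0 ID IM] := idI.
have [|p [H [pp Hirr Hdvd]]] := proper_ideal_reduction idI N0 IN nI1.
  by exists (fpoly n); rewrite ?monic_fpoly // (ev_fpoly hf).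
have pF := pchar_Fp pp; pose red := map_poly (intr : int -> 'F_p).
have redp r : red (p%:Z%:P * r) = 0.
  by rewrite /red rmorphM /= map_polyC /= -pmulrn pcharf0 // mul0r.
have p0 : p%:R != 0 :> algC by rewrite pnatr_eq0 -lt0n prime_gt0.
have lift g : exists G : {poly int}, red G = g := poly_Fp_lift g.
have factor G : I (ev th G) -> exists Q s, G = Q * H + p%:Z%:P * s.
  move=> /Hdvd/dvdpP[q Eq]; have [Q EQ] := lift q.
  have [|s Es] := @poly_int_reduction _ p pF (G - Q * H).
    by rewrite rmorphB rmorphM /= -/(red Q) EQ Eq subrr.
  by exists Q, s; rewrite -Es addrC subrK.
have [|K [r Ef]] := factor (fpoly n); first by rewrite (ev_fpoly hf).
pose w := ev th K / p%:R.
have wp : w * p%:R = ev th K by rewrite divfK.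
have wH : w * ev th H = - ev th r.
  apply: (mulIf p0); have := congr1 (ev th) Ef.
  rewrite (ev_fpoly hf) evD !evM evC -pmulrn -wp => /esym/eqP.
  by rewrite addr_eq0 => /eqP E; rewrite mulrAC E; ring.
(* For [x = Q H + p s] at [th], [w x = - Q r + K s], since [w H = - r] and [w p = K]. *)
have wI : colon_ring th I w.
  move=> x Ix; have [g Eg] := IR x Ix.
  have [|Q [s Es]] := factor g; first by rewrite /ev -Eg.
  have -> : w * x = - (ev th Q * ev th r) + ev th K * ev th s.
    rewrite Eg -/(ev th g) Es evD !evM evC -pmulrn -wp mulrDr mulrCA wH; ring.
  by rewrite -!evM -evN -evD; apply: Zth_ev.
(* From here on [w I <= I] is assumed, in order to put 1 in [M = (p, H(th))]. *)
exists w; split=> //; have [//|nex] := classic (exists x, I x /\ ~ I (w * x)).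
have wstab x : I x -> I (w * x).
  by move=> Ix; apply: NNPP => nIwx; apply: nex; exists x.
pose M := fun x => exists u v,
  [/\ Zth th u, Zth th v & x = u * ev th H + v * p%:R].
have idM : is_ideal th M.
  split.
  - move=> _ [u [v [Ru Rv ->]]]; apply: ZthD; apply: ZthM => //.
      exact: Zth_ev.
    exact: Zth_nat.
  - by exists 0, 0; split; [exact: Zth_int th 0 | exact: Zth_int th 0 | ring].
  - move=> _ _ [u [v [Ru Rv ->]]] [u' [v' [Ru' Rv' ->]]].
    by exists (u + u'), (v + v'); split; [exact: ZthD | exact: ZthD | ring].
  - move=> z _ Rz [u [v [Ru Rv ->]]].
    by exists (z * u), (z * v); split; [exact: ZthM | exact: ZthM | ring].
have nM1 : ~ M 1.
  move=> [_ [_ [[U ->] [V ->] E]]].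
  have /Hdvd : I (ev th (1 - U * H - p%:Z%:P * V)).
    rewrite !evD !evN ev1 !evM evC -pmulrn.
    suff -> : 1 - ev th U * ev th H - p%:R * ev th V = 0 by [].
    by rewrite [X in X - _ - _]E -/(ev th U) -/(ev th V); ring.
  rewrite -/(red _) /red !rmorphB rmorph1 rmorphM /= -/(red (p%:Z%:P * V)) redp subr0.
  rewrite dvdp_subl ?dvdp_mulIr //.
  by rewrite dvdp1 => /eqP s1; have [] := Hirr; rewrite s1.
have wN i : I (w ^+ i * N%:R).
  by elim: i => [|i IH]; rewrite ?expr0 ?mul1r // exprS -mulrA; apply: wstab.
have [i [j [ij Rij]]] := pow_pigeonhole hf N0 (fun i => IR _ (wN i)).
suff [m0 [m1 [Mm0 Mm1 E]]] : exists m0 m1, [/\ M m0, M m1 & 1 = m0 + m1 * w].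
  by case: nM1; apply: ideal1_of_integral idM Mm0 Mm1 E ij Rij.
(* If [T] is prime to [H] modulo [p], then [1 = U H + V T + p s], where [V T = (V t) w] at [th].
   This serves for [T = K], [t = p] and for [T = r], [t = - H]; nonsingularity prevents [H] from
   dividing both [K] and [r] modulo [p]. *)
have Bezout (T : {poly int}) t : ~~ (red H %| red T) ->
    M t -> ev th T = t * w ->
    exists m0 m1, [/\ M m0, M m1 & 1 = m0 + m1 * w].
  rewrite -irreducible_poly_coprime // => /Bezout_eq1_coprimepP[[u v] /= uv] Mt ET.
  have [[U EU] [V EV]] := (lift u, lift v).
  have [|s Es] := @poly_int_reduction _ p pF (1 - (U * H + V * T)).
    by rewrite rmorphB rmorphD !rmorphM rmorph1 /= -!/(red _) EU EV uv subrr.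
  exists (ev th U * ev th H + ev th s * p%:R), (ev th V * t); split.
  - by exists (ev th U), (ev th s); split=> //; apply: Zth_ev.
  - by case: idM => _ _ _; apply=> //; apply: Zth_ev.
  have := congr1 (ev th) Es; rewrite evD ev1 evN evD !evM evC -pmulrn ET.
  by move/eqP; rewrite subr_eq => /eqP E1; apply: (etrans E1); ring.
have Mp : M p%:R.
  by exists 0, 1; split; [exact: Zth_int th 0 | exact: Zth1 | ring].
have MH : M (- ev th H).
  exists (-1), 0; split; [exact: Zth_int th (-1) | exact: Zth_int th 0 | ring].
have [hK|/Bezout/(_ Mp)] := boolP (red H %| red K); last by apply; rewrite mulrC.
have [hr|/Bezout/(_ MH)] := boolP (red H %| red r); last first.
  by apply; rewrite mulNr mulrC wH opprK.
have [c] := singular_of_double_factor pp Ef (fst Hirr) hK hr.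
by move/nsing; case.
Qed.

Lemma invertible_of_nonsingular n (th : algC) :
  root (map_poly intr (fpoly n)) th ->
  (forall c p, prime p -> ~ singular_at n c p) -> class_monoid_is_group th.
Proof.
move=> hf nsing I nzI; have [idI [x [Ix x0]]] := nzI.
have [IR I0 ID IM] := idI; apply: invertible_colon_ring => //.
have [D [D0 [y [Ry E]]]] := Zth_div_int hf (IR x Ix) x0.
have ID' : I D%:~R by rewrite -E; apply: IM.
have IN : I (`|D|%N)%:R.
  have [s Es] : exists s : int, `|D|%N%:Z = s * D.
    by exists (sgz D); exact: abszEsg.
  by rewrite pmulrn Es rmorphM; apply: IM => //; apply: Zth_int.
have N0 : (0 < `|D|)%N by rewrite absz_gt0.
exact: colon_ring_of_step hf N0 (colon_ring_step hf N0 nsing) I idI IN.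
Qed.

(** * The ideal [(th - c, p)] at a singular point *)

Lemma nonzero_ideal2 th c (p : int) : p != 0 -> Zth th th ->
  nonzero_ideal th (ideal2 th c p).
Proof.
move=> p0 Rth; split; last first.
  exists p%:~R; rewrite intr_eq0; split=> //; exists 0, 1.
  by split; [exact: Zth_int th 0 | exact: Zth1 | ring].
split.
- move=> _ [u [v [Ru Rv ->]]]; apply: ZthD; apply: ZthM => //; last exact: Zth_int.
  by apply: ZthB => //; apply: Zth_int.
- by exists 0, 0; split; [exact: Zth_int th 0 | exact: Zth_int th 0 | ring].
- move=> _ _ [u [v [Ru Rv ->]]] [u' [v' [Ru' Rv' ->]]].
  by exists (u + u'), (v + v'); split; [exact: ZthD | exact: ZthD | ring].
- move=> z _ Rz [u [v [Ru Rv ->]]].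
  by exists (z * u), (z * v); split; [exact: ZthM | exact: ZthM | ring].
Qed.

(* With [q = (fpoly n - fpoly n c) / (X - c)], the element [q(th) / p] stabilises
   the ideal: [q(th) (th - c) = - f(c)] and [q(th) = f'(c) mod (th - c)]. *)
Lemma singular_not_invertible n (th : algC) c p :
  root (map_poly intr (fpoly n)) th -> prime p -> singular_at n c p ->
  ~ invertible_ideal th (ideal2 th c p%:Z).
Proof.
move=> hf pp [/dvdzP[k Ek] /dvdzP[l El]].
have p0 : p%:R != 0 :> algC by rewrite pnatr_eq0 -lt0n prime_gt0.
have Rth : Zth th th by exists 'X; rewrite map_polyX hornerX.
pose q := th ^+ 2 + (c - n)%:~R * th + (c ^+ 2 - n * c + (n - 1))%:~R.
pose w := q / p%:R; have wp : w * p%:R = q by rewrite divfK.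
have Eth : th ^+ 3 = n%:~R * th ^+ 2 - (n - 1)%:~R * th + 1.
  have := ev_fpoly hf; rewrite /fpoly -['X^3]/('X * ('X * 'X)).
  rewrite -['X^2]/('X * 'X) !(evD, evN, evM, evC, evX, ev1).
  by move/eqP; rewrite -subr_eq0 => /eqP E; apply/eqP; rewrite -subr_eq0 -E; apply/eqP; ring.
(* This is [- f(c) / p], with [f(c) = l p ^ 2]. *)
have wc : w * (th - c%:~R) = (- l * p%:Z)%:~R.
  apply: (mulIf p0); rewrite mulrAC wp.
  have -> : (- l * p%:Z)%:~R * p%:R = - ((fpoly n).[c])%:~R :> algC.
    by rewrite El -mulnn PoszM !(rmorphM, rmorphN) /= -!pmulrn; ring.
  rewrite horner_fpoly /q !(rmorphB, rmorphD, rmorphM, rmorphXn) /=.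
  transitivity (th ^+ 3 - c%:~R ^+ 3 - n%:~R * (th ^+ 2 - c%:~R ^+ 2)
                + (n%:~R - 1) * (th - c%:~R)); first by ring.
  by rewrite Eth rmorphB; ring.
move/(stabilizer_invertible (w := w)) => H.
have /(Zth_coords hf)[a [b [d Ew]]] : Zth th w.
  apply: H => _ [u [v [Ru Rv ->]]].
  (* Coefficients of [w x] for [x = u (th - c) + v p]: use [w (th - c) = - l p] and
     [w p = q = (th - c) (th + 2c - n) + f'(c)], with [f'(c) = k p]. *)
  exists (v * (th + (2 * c - n)%:~R)), (- u * l%:~R + v * k%:~R); split.
  - by apply: ZthM => //; apply: ZthD => //; apply: Zth_int.
  - by apply: ZthD; apply: ZthM => //; [apply: ZthN | | ]; rewrite //; apply: Zth_int.
  rewrite mulrDr mulrCA wc -pmulrn [w * _]mulrCA wp.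
  have -> : q = (th - c%:~R) * (th + (2 * c - n)%:~R) + k%:~R * p%:R.
    have -> : k%:~R * p%:R = ((fpoly n)^`().[c])%:~R :> algC.
      by rewrite Ek rmorphM.
    have -> : (fpoly n)^`().[c] = 3 * c ^+ 2 - 2 * n * c + n - 1.
      by rewrite /fpoly !derivE !hornerE /=; ring.
    by rewrite /q !(rmorphB, rmorphD, rmorphM, rmorphXn) /=; ring.
  by rewrite !(rmorphM, rmorphN) /= -pmulrn; ring.
(* [q] is monic of degree 2 in [th], so comparing the last coordinates in [q = p w] yields
   [1 = p d]. *)
have /(coord2_eq0 hf) : (c ^+ 2 - n * c + (n - 1) - p%:Z * a)%:~R
    + (c - n - p%:Z * b)%:~R * th + (1 - p%:Z * d)%:~R * th ^+ 2 = 0.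
  have : q - p%:R * w = 0 by rewrite -wp mulrC subrr.
  rewrite Ew /q => <-.
  by rewrite !(rmorphB, rmorphD, rmorphM, rmorphXn) /= -pmulrn; ring.
move=> pd; have : (p%:Z %| 1)%Z by apply/dvdzP; exists d; rewrite mulrC; lia.
by rewrite dvdz1 /= => /eqP p1; rewrite p1 in pp.
Qed.

Unset Implicit Arguments.

Theorem theorem3 (n : int) (th : algC)
  (hroot : root (map_poly intr (fpoly n)) th) :
  (~ class_monoid_is_group th <->
     exists (c : int) (p : nat), [/\ prime p,
       ((2 * c - 1) * n == 3 * c ^+ 2 - 1 %[mod p%:Z])%Z &
       ((c ^+ 2 - c) * n == c ^+ 3 - c - 1 %[mod (p ^ 2)%:Z])%Z])
  /\
  (forall (c : int) (p : nat), prime p ->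
     ((2 * c - 1) * n == 3 * c ^+ 2 - 1 %[mod p%:Z])%Z ->
     ((c ^+ 2 - c) * n == c ^+ 3 - c - 1 %[mod (p ^ 2)%:Z])%Z ->
     ~ invertible_ideal th (ideal2 th c p%:Z)).
Proof.
have noninv c p : prime p ->
    ((2 * c - 1) * n == 3 * c ^+ 2 - 1 %[mod p%:Z])%Z ->
    ((c ^+ 2 - c) * n == c ^+ 3 - c - 1 %[mod (p ^ 2)%:Z])%Z ->
    ~ invertible_ideal th (ideal2 th c p%:Z).
  move=> pp h1 h2; apply: singular_not_invertible hroot pp _.
  by apply/singular_atP.
split=> //; split=> [ngrp|[c [p [pp h1 h2]]] grp]; last first.
  apply: (noninv c p pp h1 h2); apply: grp; apply: nonzero_ideal2.
    by rewrite -lt0n prime_gt0.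
  by exists 'X; rewrite map_polyX hornerX.
apply: NNPP => nex; apply: ngrp; apply: invertible_of_nonsingular hroot _.
by move=> c p pp /singular_atP[h1 h2]; apply: nex; exists c, p.
Qed.
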